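(* Let $\mathcal{K}=\{c_0,c_1,c_2,c_3,c_4\}$ be a finite hypergroup of order five whose involution on $K$ is given by $c_0^*=c_0$, $c_1^*=c_4$, $c_2^*=c_3$, $c_3^*=c_2$, $c_4^*=c_1$. Then $\mathcal{K}$ is commutative.
   Context: For a finite set $K=\{c_0,c_1,\dots,c_n\}$ (distinct elements), let $M^b(K)=\{\sum_{j=0}^n a_j\delta_{c_j}: a_j\in\mathbb{C}\}$ be the complex measures on $K$ and $M^1(K)=\{\sum_j a_j\delta_{c_j}: a_j\ge 0,\ \sum_j a_j=1\}$ the probability measures, where $\delta_c$ is the Dirac measure at $c$. The support of $\mu=\sum_j a_j\delta_{c_j}$ is $\mathrm{supp}(\mu)=\{c_j: a_j\neq 0\}$. A finite hypergroup $\mathcal{K}=(K,M^b(K),\circ,* )$ (also written $\mathcal{K}=\{c_0,\dots,c_n\}$) is a finite set $K=\{c_0,\dots,c_n\}$ together with a product $\circ$ (convolution) and an involution $*$ on $M^b(K)$ such that: (a) $(M^b(K),\circ,* )$ is an associative $*$-algebra with unit $\delta_{c_0}$; (b) $\delta_{c_i}\circ\delta_{c_j}\in M^1(K)$ for all $c_i,c_j\in K$; (c) there is an involutive bijection $c_i\mapsto c_i^*$ of $K$ with $\delta_{c_i^*}=\delta_{c_i}^*$, and for all $c_i,c_j\in K$ one has $c_j=c_i^*$ if and only if $c_0\in\mathrm{supp}(\delta_{c_i}\circ\delta_{c_j})$. The order of $\mathcal{K}$ is the number of elements of $K$. $\mathcal{K}$ is commutative if $\circ$ is commutative on $M^b(K)$.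 *)

(* Defs.v *)
From mathcomp Require Import all_boot all_order all_algebra.
From mathcomp Require Import reals.
From mathcomp.real_closed Require Import complex.

Set Implicit Arguments.
Unset Strict Implicit.
Unset Printing Implicit Defensive.

Import Order.TTheory GRing.Theory Num.Theory.
Local Open Scope ring_scope.

(* The measure [\sum_j a_j \delta_(c_j)] is encoded by its weights
   [c_j |-> a_j]. The codomain is [R[i]^o] so that measures form a vector
   space over [R[i]]. *)
Notation "'M^b[' R ]( K )" := {ffun K -> R[i]^o}
  (at level 0, K at level 200, format "'M^b[' R ]( K )") : type_scope.

Definition dirac (R : realType) (K : finType) (c : K) : M^b[R](K) :=
  [ffun x => (x == c)%:R].

Definition supp (R : realType) (K : finType) (mu : M^b[R](K)) : {set K} :=
  [set c | mu c != 0].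

(* In [R[i]], [0 <= a] means that [a] is real and nonnegative. *)
Definition is_prob (R : realType) (K : finType) (mu : M^b[R](K)) : Prop :=
  (forall c, 0 <= (mu c : R[i])) /\ \sum_(c : K) (mu c : R[i]) = 1.

Record hypergroup (R : realType) (K : finType) (c0 : K) : Type := Hypergroup {
  hg_conv : M^b[R](K) -> M^b[R](K) -> M^b[R](K);
  hg_star : M^b[R](K) -> M^b[R](K);
  hg_inv : K -> K;
  hg_conv_linearr : forall mu : M^b[R](K), linear (hg_conv mu);
  hg_conv_linearl : forall nu : M^b[R](K), linear (hg_conv^~ nu);
  hg_convA : associative hg_conv;
  hg_conv1m : left_id (dirac R c0) hg_conv;
  hg_convm1 : right_id (dirac R c0) hg_conv;
  hg_star_conjlinear : forall (a : R[i]) (mu nu : M^b[R](K)),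
    hg_star (a *: mu + nu) = Num.conj a *: hg_star mu + hg_star nu;
  hg_starK : involutive hg_star;
  hg_star_conv : forall mu nu : M^b[R](K),
    hg_star (hg_conv mu nu) = hg_conv (hg_star nu) (hg_star mu);
  hg_conv_prob : forall ci cj : K, is_prob (hg_conv (dirac R ci) (dirac R cj));
  hg_invK : involutive hg_inv;
  hg_star_dirac : forall c : K, hg_star (dirac R c) = dirac R (hg_inv c);
  hg_supp_conv : forall ci cj : K,
    cj = hg_inv ci <-> c0 \in supp (hg_conv (dirac R ci) (dirac R cj))
}.

Definition commutative_hypergroup (R : realType) (K : finType) (c0 : K)
    (H : hypergroup R c0) : Prop :=
  commutative (hg_conv H).

(* Main.v *)
Require Import Defs.
From HB Require Import structures.
From mathcomp Require Import all_boot all_order all_algebra.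
From mathcomp Require Import reals.
From mathcomp.real_closed Require Import complex.

Set Implicit Arguments.
Unset Strict Implicit.
Unset Printing Implicit Defensive.

(** Conceptually, a noncommutative [*]-algebra here would be [R + M_2(R)] or
    [R + Quaternions] over the reals, whose skew parts have dimension 1 and 3,
    whereas this involution makes the real skew part two-dimensional, spanned
    by [a = c1 - c4] and [b = c2 - c3].  An elementary version runs as follows.
    Since [tau x = x c0] is a faithful positive functional, a skew nilpotent
    element is [0].  The commutator [u = a b - b a] and its cube are real and
    skew, hence combinations of [a] and [b]; this forces [u ^ 4 = 0], so
    [u = 0].  Then [a a], [a b], [b b] are real, self-adjoint and of total mass
    [0], so they lie in the plane spanned by [p = c1 + c4 - 2] and
    [q = c2 + c3 - 2].  If they span it, everything is a polynomial in [a] and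
    [b].  Otherwise [a b] and [b b] are real multiples [mu a a] and [nu a a], and
    [b - mu a] is skew, nilpotent and nonzero, a contradiction. *)

Import Order.TTheory GRing.Theory Num.Theory.
Local Open Scope ring_scope.

(** * Commutators, nilpotents and linear combinations in an algebra over a numeric field *)

Section Algebra.
Variables (F : numFieldType) (A : algType F).

(** The commutator with [a] is a derivation, so by the Leibniz rule each of the [n] factors [u]
    contributes one [k]. *)
Lemma commutator_eigen_exp (a u : A) (k : F) (n : nat) :
  a * u - u * a = k *: u -> a * u ^+ n - u ^+ n * a = (k *+ n) *: u ^+ n.
Proof.
move=> auE; elim: n => [|n IHn]; first by rewrite mulr1 mul1r subrr scale0r.
have -> : a * u ^+ n.+1 - u ^+ n.+1 * a
    = (a * u - u * a) * u ^+ n + u * (a * u ^+ n - u ^+ n * a).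
  by rewrite exprS mulrBl mulrBr !mulrA addrA subrK.
by rewrite auE IHn -scalerAl -scalerAr -exprS -scalerDl -mulrS.
Qed.

(* [ad a] and [ad b] scale [u], hence scale [u ^ 3] by three times as much;
   comparing with the expansion of [u ^ 3] on [a], [b] gives [u ^ 4 = 3 u ^ 4]. *)
Lemma lie_commutator_pow4_eq0 (a b : A) (al be x y : F) :
    a * b - b * a = al *: a + be *: b ->
    (a * b - b * a) ^+ 3 = x *: a + y *: b ->
  (a * b - b * a) ^+ 4 = 0.
Proof.
set u := a * b - b * a => uE u3E.
have au : a * u - u * a = be *: u.
  rewrite {1 2}uE mulrDr mulrDl -!scalerAl -!scalerAr.
  by rewrite opprD addrACA subrr add0r -scalerBr.
have ub : u * b - b * u = al *: u.
  rewrite {1 2}uE mulrDr mulrDl -!scalerAl -!scalerAr.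
  by rewrite opprD addrACA subrr addr0 -scalerBr.
have au3 := commutator_eigen_exp 3 au.
have bu : b * u - u * b = - al *: u by rewrite -opprB ub scaleNr.
have u3b : u ^+ 3 * b - b * u ^+ 3 = (al *+ 3) *: u ^+ 3.
  by rewrite -opprB (commutator_eigen_exp 3 bu) mulNrn scaleNr opprK.
have yE : y *: u = (be *+ 3) *: u ^+ 3.
  rewrite -au3 u3E mulrDr mulrDl -!scalerAl -!scalerAr.
  by rewrite opprD addrACA subrr add0r -scalerBr.
have xE : x *: u = (al *+ 3) *: u ^+ 3.
  rewrite -u3b u3E mulrDr mulrDl -!scalerAl -!scalerAr.
  by rewrite opprD addrACA subrr addr0 -scalerBr.
have : u ^+ 4 = u ^+ 4 *+ 3.
  rewrite {1}exprSr {1}u3E mulrDl -!scalerAl !(scalerAr _ _ u) xE yE.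
  by rewrite -!scalerAr -!scalerMnl -mulrnDl !scalerAl -mulrDl -uE -exprS.
move/eqP; rewrite mulrS -[X in X == _]addr0 (inj_eq (addrI _)) eq_sym.
by rewrite -scaler_nat scaler_eq0 pnatr_eq0 /= => /eqP.
Qed.

(** With [v = b - mu *: a], one has [a * v = 0] while [v * v] is a multiple of [a * a]. Already the
    cube vanishes; the exponent 4 matches [skew_pow4_eq0]. *)
Lemma proportional_products_nilpotent (a b : A) (mu nu : F) :
    GRing.comm a b -> a * b = mu *: (a * a) -> b * b = nu *: (a * a) ->
  (b - mu *: a) ^+ 4 = 0.
Proof.
set v := b - mu *: a => cab abE bbE.
have av : a * v = 0 by rewrite mulrBr abE -scalerAr subrr.
have vv : v * v = (nu - mu ^+ 2) *: (a * a).
  rewrite {1}/v mulrBl -scalerAl av scaler0 subr0 mulrBr bbE -scalerAr.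
  by rewrite -cab abE scalerA -scalerBl.
by rewrite !exprSr expr0 mul1r vv -scalerAl -mulrA av mulr0 scaler0 mul0r.
Qed.

Lemma commrZ (z x : A) (k : F) : GRing.comm z x -> GRing.comm z (k *: x).
Proof. by rewrite /GRing.comm -scalerAr -scalerAl => ->. Qed.

Lemma comm_add_sub (z x y : A) :
  GRing.comm z (x + y) -> GRing.comm z (x - y) -> GRing.comm z x /\ GRing.comm z y.
Proof.
move=> cD cB.
have two : (2%:R : F) != 0 by rewrite pnatr_eq0.
have xE : x = 2%:R^-1 *: ((x + y) + (x - y)).
  by rewrite addrACA subrr addr0 -mulr2n -scaler_nat scalerA mulVf// scale1r.
have yE : y = 2%:R^-1 *: ((x + y) - (x - y)).
  by rewrite opprB [x + y]addrC addrACA subrr addr0 -mulr2n -scaler_nat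
    scalerA mulVf// scale1r.
split; first by rewrite xE; apply: commrZ; apply: commrD.
by rewrite yE; apply: commrZ; apply: commrB.
Qed.

(** Cramer's rule puts [p] and [q] in the span of [x] and [y], and the centralizer of [z] is a
    subspace. *)
Lemma comm_cramer (z p q x y : A) (x1 x2 y1 y2 : F) :
    x = x1 *: p + x2 *: q -> y = y1 *: p + y2 *: q -> x1 * y2 != x2 * y1 ->
    GRing.comm z x -> GRing.comm z y ->
  GRing.comm z p /\ GRing.comm z q.
Proof.
move=> -> -> Dn0 cx cy; rewrite -subr_eq0 in Dn0.
have pE : (x1 * y2 - x2 * y1) *: p
    = y2 *: (x1 *: p + x2 *: q) - x2 *: (y1 *: p + y2 *: q).
  rewrite !scalerDr !scalerA opprD addrACA -!scalerBl [x2 * y2]mulrC subrr.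
  by rewrite scale0r addr0 [y2 * x1]mulrC.
have qE : (x1 * y2 - x2 * y1) *: q
    = x1 *: (y1 *: p + y2 *: q) - y1 *: (x1 *: p + x2 *: q).
  rewrite !scalerDr !scalerA opprD addrACA -!scalerBl [x1 * y1]mulrC subrr.
  by rewrite scale0r add0r [y1 * x2]mulrC.
split; [rewrite -(scalerK Dn0 p) pE|rewrite -(scalerK Dn0 q) qE];
  by apply: commrZ; apply: commrB; apply: commrZ.
Qed.

(** The multiplier is the ratio of coefficients at a nonzero coefficient of [x]. Its reality matters
    later because the star is conjugate-linear. *)
Lemma proportional_combinations (p q x y : A) (x1 x2 y1 y2 : F) :
    x = x1 *: p + x2 *: q -> y = y1 *: p + y2 *: q ->
    x1 \is Num.real -> x2 \is Num.real -> y1 \is Num.real -> y2 \is Num.real ->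
    x != 0 -> x1 * y2 = x2 * y1 ->
  exists2 mu, mu \is Num.real & y = mu *: x.
Proof.
move=> -> -> rx1 rx2 ry1 ry2 xn0 xy.
have [x10|x1n0] := eqVneq x1 0; last first.
  exists (y1 / x1); first by rewrite realM ?realV.
  by rewrite scalerDr !scalerA divfK// mulrAC [y1 * x2]mulrC -xy mulrAC mulfV// mul1r.
have [x20|x2n0] := eqVneq x2 0.
  by rewrite x10 x20 !scale0r addr0 eqxx in xn0.
exists (y2 / x2); first by rewrite realM ?realV.
by rewrite scalerDr !scalerA divfK// mulrAC [y2 * x1]mulrC xy mulrAC mulfV// mul1r.
Qed.

End Algebra.

Lemma skew_combination (F : pzRingType) (V : lmodType F) (d1 d2 d3 d4 : V) (k1 k2 : F) :
  k1 *: d1 + k2 *: d2 + (- k2) *: d3 + (- k1) *: d4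
    = k1 *: (d1 - d4) + k2 *: (d2 - d3).
Proof.
by rewrite !scalerBr !scaleNr [RHS]addrACA [- _ - _]addrC addrA.
Qed.

Lemma symmetric_combination (F : pzRingType) (V : lmodType F) (d0 d1 d2 d3 d4 : V)
    (k1 k2 : F) :
  - (k1 *+ 2 + k2 *+ 2) *: d0 + k1 *: d1 + k2 *: d2 + k2 *: d3 + k1 *: d4
    = k1 *: (d1 + d4 - d0 *+ 2) + k2 *: (d2 + d3 - d0 *+ 2).
Proof.
rewrite !scalerBr [RHS]addrACA -opprD -!scalerMnr !scalerMnl -scalerDl [RHS]addrC.
rewrite scaleNr !scalerDr -!addrA; congr (_ + (_ + _)).
by rewrite [RHS]addrC addrA.
Qed.

(** * The convolution algebra of a finite hypergroup and its faithful positive functional *)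

Lemma diracE (R : realType) (K : finType) (c d : K) :
  dirac R c d = (d == c)%:R :> R[i].
Proof. exact: ffunE. Qed.

(* The phantom argument [H] lets instance inference find the convolution. *)
Definition conv_alg (R : realType) (K : finType) (c0 : K)
  (H : hypergroup R c0) : Type := M^b[R](K).

Section ConvAlg.
Variables (R : realType) (K : finType) (c0 : K) (H : hypergroup R c0).
Local Notation A := (conv_alg H).

HB.instance Definition _ := GRing.Lmodule.copy A M^b[R](K).

Fact conv_mulDl : left_distributive (hg_conv H : A -> A -> A) +%R.
Proof.
by move=> x y z; have := hg_conv_linearl H z 1 x y; rewrite !scale1r.
Qed.

Fact conv_mulDr : right_distributive (hg_conv H : A -> A -> A) +%R.
Proof.
by move=> x y z; have := hg_conv_linearr H x 1 y z; rewrite !scale1r.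
Qed.

Fact conv_oner_neq0 : (dirac R c0 : A) != 0.
Proof. by apply/eqP => /ffunP/(_ c0)/eqP; rewrite !ffunE eqxx oner_eq0. Qed.

HB.instance Definition _ := GRing.Zmodule_isNzRing.Build A
  (@hg_convA _ _ _ H) (@hg_conv1m _ _ _ H) (@hg_convm1 _ _ _ H)
  conv_mulDl conv_mulDr conv_oner_neq0.

Fact conv_scalerAl (k : R[i]) (x y : A) : k *: (x * y) = k *: x * y.
Proof.
have := hg_conv_linearl H y k x 0 : (k *: x + 0) * y = k *: (x * y) + 0 * y.
by rewrite mul0r !addr0.
Qed.

HB.instance Definition _ := GRing.Lmodule_isLalgebra.Build R[i] A conv_scalerAl.

Fact conv_scalerAr (k : R[i]) (x y : A) : k *: (x * y) = x * (k *: y).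
Proof.
have := hg_conv_linearr H x k y 0 : x * (k *: y + 0) = k *: (x * y) + x * 0.
by rewrite mulr0 !addr0.
Qed.

HB.instance Definition _ := GRing.Lalgebra_isAlgebra.Build R[i] A conv_scalerAr.

Local Notation star := (hg_star H : A -> A).
Local Notation delta c := (dirac R c : A).

Lemma conv_scaleE (k : R[i]) (x : A) c : (k *: x) c = k * x c :> R[i].
Proof. exact: ffunE. Qed.

Lemma conv_subE (x y : A) c : (x - y) c = x c - y c :> R[i].
Proof. by rewrite !ffunE. Qed.

Lemma conv_sumE (I : finType) (F : I -> A) c :
  (\sum_i F i) c = \sum_i F i c :> R[i].
Proof. exact: sum_ffunE. Qed.

Lemma dirac_sumE (x : A) : x = \sum_c (x c : R[i]) *: delta c.
Proof.
apply/ffunP => d; rewrite conv_sumE.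
under eq_bigr do rewrite conv_scaleE diracE eq_sym.
rewrite (bigD1 d) //= eqxx mulr1 big1 ?addr0 // => c /negPf ->.
exact: mulr0.
Qed.

Lemma conv_coordE (x y : A) c :
  (x * y) c = \sum_i \sum_j (x i : R[i]) * y j * (delta i * delta j) c.
Proof.
rewrite {1}(dirac_sumE x) {1}(dirac_sumE y) mulr_suml conv_sumE.
apply: eq_bigr => i _; rewrite mulr_sumr conv_sumE.
by apply: eq_bigr => j _; rewrite -scalerAl -scalerAr scalerA conv_scaleE.
Qed.

Lemma dirac_conv_ge0 i j c : 0 <= ((delta i * delta j) c : R[i]).
Proof. by have [] := hg_conv_prob H i j. Qed.

(** Products of Dirac measures have mass 1, so total mass is multiplicative. *)
Lemma sum_conv (x y : A) :
  \sum_c ((x * y) c : R[i]) = (\sum_c (x c : R[i])) * (\sum_c (y c : R[i])).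
Proof.
under eq_bigr do rewrite conv_coordE.
rewrite exchange_big mulr_suml; apply: eq_bigr => i _.
rewrite exchange_big mulr_sumr; apply: eq_bigr => j _.
have [_ sum1] := hg_conv_prob H i j.
by rewrite -mulr_sumr [X in _ * X]sum1 mulr1.
Qed.

Lemma sum_diracB c d : \sum_e ((delta c - delta d) e : R[i]) = 0.
Proof.
have sum_dirac e : \sum_f (delta e f : R[i]) = 1.
  under eq_bigr do rewrite diracE.
  by rewrite (bigD1 e) //= eqxx big1 ?addr0// => f /negPf ->.
under eq_bigr do rewrite conv_subE.
by rewrite sumrB !sum_dirac subrr.
Qed.

Lemma star_is_zmod_morphism : zmod_morphism star.
Proof.
move=> x y; have := hg_star_conjlinear H (-1) y x.
by rewrite rmorphN1 !scaleN1r => starB; rewrite addrC [LHS]starB addrC.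
Qed.

HB.instance Definition _ :=
  GRing.isZmodMorphism.Build A A star star_is_zmod_morphism.

Lemma starZ (k : R[i]) (x : A) : star (k *: x) = Num.conj k *: star x.
Proof.
have := hg_star_conjlinear H k x 0 : star (k *: x + 0) = Num.conj k *: star x + star 0.
by rewrite raddf0 !addr0.
Qed.

Lemma starM (x y : A) : star (x * y) = star y * star x.
Proof. exact: hg_star_conv. Qed.

Lemma star_coordE (x : A) c : star x c = Num.conj (x (hg_inv H c) : R[i]).
Proof.
rewrite {1}(dirac_sumE x) raddf_sum /= conv_sumE.
under eq_bigr => d _ do
  rewrite starZ [star (delta _)]hg_star_dirac conv_scaleE diracE.
rewrite (bigD1 (hg_inv H c)) //= hg_invK eqxx mulr1 big1 ?addr0 // => d dc.
case: eqP => [cE|_]; last exact: mulr0.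
by rewrite cE hg_invK eqxx in dc.
Qed.

(** The [c0] coordinate of [star x * x] is a sum of the squares [|x c|^2] with positive weights. *)
Lemma star_mul_eq0 (x : A) : star x * x = 0 -> x = 0.
Proof.
move=> /ffunP/(_ c0); rewrite conv_coordE !ffunE (reindex_inj (inv_inj (hg_invK H))) /=.
have term_ge0 c : 0 <= (Num.conj (x c : R[i]) * x c * (delta (hg_inv H c) * delta c) c0 : R[i]).
  by rewrite mulr_ge0 ?dirac_conv_ge0// mulrC mul_conjC_ge0.
(* By the support axiom only the pair of [c] with its inverse reaches [c0], so the double sum
   reduces to its diagonal. *)
have rowE c : \sum_d (star x (hg_inv H c) : R[i]) * x d * (delta (hg_inv H c) * delta d) c0
   = Num.conj (x c : R[i]) * x c * (delta (hg_inv H c) * delta c) c0.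
  rewrite star_coordE hg_invK (bigD1 c) //= big1 ?addr0 // => d dc.
  have /eqP -> : (delta (hg_inv H c) * delta d) c0 == 0.
    apply: contraNT dc => nz; apply/eqP.
    by rewrite (proj2 (hg_supp_conv H (hg_inv H c) d)) ?hg_invK// inE.
  exact: mulr0.
under eq_bigr do rewrite rowE.
move=> /(psumr_eq0P (fun c _ => term_ge0 c)) x0; apply/ffunP => c; rewrite ffunE.
apply/eqP; move/eqP: (x0 c isT); rewrite mulf_eq0 mulrC mul_conjC_eq0 => /orP[//|].
(* The same axiom makes the diagonal weights nonzero. *)
have : c0 \in supp (hg_conv H (dirac R (hg_inv H c)) (dirac R c)).
  by apply/(hg_supp_conv H); rewrite hg_invK.
by rewrite inE => /eqP nz /eqP F; case: nz; exact: F.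
Qed.

(** For skew [x], [x ^+ 2] is self-adjoint, so [star_mul_eq0] applies first to [x ^+ 2] and then to
    [x]. *)
Lemma skew_pow4_eq0 (x : A) : star x = - x -> x ^+ 4 = 0 -> x = 0.
Proof.
move=> skew x4; apply: star_mul_eq0; rewrite skew mulNr -expr2.
suff -> : x ^+ 2 = 0 by rewrite oppr0.
by apply: star_mul_eq0; rewrite starM skew mulrNN -expr2 -exprD.
Qed.

(** Multiplication by [i] exchanges skew and self-adjoint elements; real coordinates keep the two
    apart, since there the star only permutes coordinates. *)
Definition real_coords (x : A) : Prop := forall c, (x c : R[i]) \is Num.real.

Lemma real_coordsB (x y : A) : real_coords x -> real_coords y -> real_coords (x - y).
Proof. by move=> rx ry c; rewrite !ffunE; exact: (rpredB (rx c) (ry c)). Qed.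

Lemma real_coordsM (x y : A) : real_coords x -> real_coords y -> real_coords (x * y).
Proof.
move=> rx ry c; rewrite conv_coordE.
apply: rpred_sum => i _; apply: rpred_sum => j _.
by rewrite !rpredM// ger0_real// dirac_conv_ge0.
Qed.

Lemma real_coords_dirac c : real_coords (delta c).
Proof. by move=> d; rewrite ffunE; apply: realn. Qed.

End ConvAlg.

(** * Order five with two pairs of mutually inverse elements *)

Section OrderFive.
Variables (R : realType) (K : finType) (c0 c1 c2 c3 c4 : K).
Hypothesis c_distinct : uniq [:: c0; c1; c2; c3; c4].
Hypothesis c_all : forall x : K, x \in [:: c0; c1; c2; c3; c4].
Variable H : hypergroup R c0.
Hypotheses (inv0 : hg_inv H c0 = c0) (inv1 : hg_inv H c1 = c4).
Hypotheses (inv2 : hg_inv H c2 = c3) (inv3 : hg_inv H c3 = c2).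
Hypothesis inv4 : hg_inv H c4 = c1.

Local Notation A := (conv_alg H).
Local Notation star := (hg_star H : A -> A).
Local Notation delta c := (dirac R c : A).
Let a : A := delta c1 - delta c4.
Let b : A := delta c2 - delta c3.
Let p : A := delta c1 + delta c4 - 2%:R.
Let q : A := delta c2 + delta c3 - 2%:R.

Lemma sum5 (V : nmodType) (F : K -> V) :
  \sum_c F c = F c0 + F c1 + F c2 + F c3 + F c4.
Proof.
have pE : perm_eq (index_enum K) [:: c0; c1; c2; c3; c4].
  by apply: uniq_perm; rewrite ?index_enum_uniq// => x; rewrite mem_index_enum c_all.
by rewrite (perm_big _ pE) !big_cons big_nil /= addr0 !addrA.
Qed.

(** Coordinates at inverse points are opposite: the one at [c0] vanishes, and those at [c1] and [c2]
    determine the rest. *)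
Lemma skew_real_coordsE (x : A) : real_coords x -> star x = - x ->
  x = (x c1 : R[i]) *: a + (x c2 : R[i]) *: b.
Proof.
move=> rx skew.
have xi c : x (hg_inv H c) = - (x c : R[i]) :> R[i].
  by rewrite -(conj_Creal (rx _)) -star_coordE skew ffunE.
have x0 : x c0 = 0 :> R[i].
  by have /eqP := xi c0; rewrite inv0 -addr_eq0 -mulr2n mulrn_eq0 => /eqP.
have x4 : x c4 = - (x c1 : R[i]) :> R[i] by rewrite -inv1.
have x3 : x c3 = - (x c2 : R[i]) :> R[i] by rewrite -inv2.
rewrite {1}(dirac_sumE x) sum5 x0 x3 x4 scale0r add0r.
exact: skew_combination.
Qed.

(** Coordinates at inverse points agree, and zero total mass fixes the one at [c0]. *)
Lemma self_adjoint_real_coordsE (x : A) :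
    real_coords x -> star x = x -> \sum_c (x c : R[i]) = 0 ->
  x = (x c1 : R[i]) *: p + (x c2 : R[i]) *: q.
Proof.
move=> rx sa.
have xi c : x (hg_inv H c) = x c :> R[i].
  by rewrite -(conj_Creal (rx _)) -star_coordE sa.
have x4 : x c4 = x c1 :> R[i] by rewrite -inv1.
have x3 : x c3 = x c2 :> R[i] by rewrite -inv2.
rewrite sum5 x3 x4 => sum0.
have x0 : x c0 = - ((x c1 : R[i]) *+ 2 + (x c2 : R[i]) *+ 2) :> R[i].
  apply/eqP; rewrite -addr_eq0 -{}sum0 !mulr2n -!addrA.
  by apply/eqP; do 2!congr (_ + _); rewrite addrC -!addrA.
rewrite {1}(dirac_sumE x) sum5 x0 x3 x4.
exact: symmetric_combination.
Qed.

Lemma real_a : real_coords a.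
Proof. by apply: real_coordsB; apply: real_coords_dirac. Qed.

Lemma real_b : real_coords b.
Proof. by apply: real_coordsB; apply: real_coords_dirac. Qed.

Lemma star_a : star a = - a.
Proof. by rewrite raddfB /= ![hg_star _ _]hg_star_dirac inv1 inv4 opprB. Qed.

Lemma star_b : star b = - b.
Proof. by rewrite raddfB /= ![hg_star _ _]hg_star_dirac inv2 inv3 opprB. Qed.

Lemma comm_ab : GRing.comm a b.
Proof.
apply/eqP; rewrite -subr_eq0; apply/eqP; set u := _ - _.
have ru : real_coords u.
  by apply: real_coordsB; apply: real_coordsM; first [exact: real_a | exact: real_b].
have su : star u = - u.
  by rewrite raddfB /= !starM star_a star_b !mulrNN opprB.
(* Odd powers of a skew element are skew, so the cube expands on [a] and [b] as [u] does. *)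
have ru3 : real_coords (u ^+ 3).
  by rewrite !exprS expr0 mulr1; do 2!apply: real_coordsM => //.
have su3 : star (u ^+ 3) = - u ^+ 3.
  by rewrite !exprS expr0 mulr1 !starM su !(mulrN, mulNr) opprK mulrA.
apply: skew_pow4_eq0 => //.
exact: lie_commutator_pow4_eq0 (skew_real_coordsE ru su) (skew_real_coordsE ru3 su3).
Qed.

Lemma skew_part_nonproportional mu nu : mu \is Num.real ->
  a * b = mu *: (a * a) -> b * b = nu *: (a * a) -> False.
Proof.
move=> rmu abE bbE.
have /skew_pow4_eq0 := proportional_products_nilpotent comm_ab abE bbE.
have -> : star (b - mu *: a) = - (b - mu *: a).
  by rewrite raddfB /= starZ star_a star_b (conj_Creal rmu) scalerN opprK [RHS]opprB addrC.
(* The element would vanish, yet its coordinate at [c2] is 1. *)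
move=> /(_ erefl) /ffunP /(_ c2) /eqP.
rewrite conv_subE conv_scaleE !conv_subE !diracE ffunE eqxx.
move: c_distinct; rewrite /= !inE !negb_or => /and5P[_ /and3P[c12 _ _] /andP[c23 c24] _ _].
rewrite [c2 == c1]eq_sym (negPf c12) (negPf c23) (negPf c24) subrr mulr0 !subr0.
by rewrite oner_eq0.
Qed.

(** The centralizer of [z] contains [a * a], [a * b] and [b * b]; the point is to reach [p] and [q]
    from these. *)
Lemma comm_all (z : A) : GRing.comm z a -> GRing.comm z b ->
  forall x, GRing.comm z x.
Proof.
move=> ca cb.
have rab := real_coordsM real_a real_b.
have raa := real_coordsM real_a real_a.
have rbb := real_coordsM real_b real_b.
have sumM0 (x y : A) : \sum_c (x c : R[i]) = 0 -> \sum_c ((x * y) c : R[i]) = 0.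
  by move=> x0; rewrite sum_conv x0 mul0r.
have aaE : a * a = ((a * a) c1 : R[i]) *: p + ((a * a) c2 : R[i]) *: q.
  apply: self_adjoint_real_coordsE => //; last by apply: sumM0; apply: sum_diracB.
  by rewrite starM star_a mulrNN.
have abE : a * b = ((a * b) c1 : R[i]) *: p + ((a * b) c2 : R[i]) *: q.
  apply: self_adjoint_real_coordsE => //; last by apply: sumM0; apply: sum_diracB.
  by rewrite starM star_a star_b mulrNN comm_ab.
have bbE : b * b = ((b * b) c1 : R[i]) *: p + ((b * b) c2 : R[i]) *: q.
  apply: self_adjoint_real_coordsE => //; last by apply: sumM0; apply: sum_diracB.
  by rewrite starM star_b mulrNN.
have caa := commrM ca ca; have cab := commrM ca cb; have cbb := commrM cb cb.
(* Since [star a = - a], a zero square would force [a = 0], against its coordinate 1 at [c1]. *)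
have aan0 : a * a != 0.
  apply/eqP => aa0; have /ffunP/(_ c1)/eqP : a = 0.
    by apply: star_mul_eq0; rewrite star_a mulNr aa0 oppr0.
  rewrite conv_subE !diracE ffunE eqxx.
  move: c_distinct; rewrite /= !inE !negb_or => /and5P[_ /and3P[_ _ c14] _ _ _].
  by rewrite (negPf c14) subr0 oner_eq0.
have [cp cq] : GRing.comm z p /\ GRing.comm z q.
  (* A nonzero determinant of [a * a] against [a * b] or [b * b] gives [p] and [q] by Cramer's rule;
     if both vanish, both products are multiples of [a * a], which is impossible. *)
  have [detab|detab] := eqVneq
    (((a * a) c1 : R[i]) * (a * b) c2) (((a * a) c2 : R[i]) * (a * b) c1); last first.
    exact: comm_cramer aaE abE detab caa cab.
  have [detbb|detbb] := eqVneq
    (((a * a) c1 : R[i]) * (b * b) c2) (((a * a) c2 : R[i]) * (b * b) c1); last first.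
    exact: comm_cramer aaE bbE detbb caa cbb.
  have [mu rmu abmu] := proportional_combinations aaE abE
    (raa _) (raa _) (rab _) (rab _) aan0 detab.
  have [nu _ bbnu] := proportional_combinations aaE bbE
    (raa _) (raa _) (rbb _) (rbb _) aan0 detbb.
  by case: (skew_part_nonproportional rmu abmu bbnu).
(* Adding 2 back to [p] and [q] gives the sums of inverse Dirac measures; [a] and [b] are their
   differences. *)
have cz2 : GRing.comm z 2%:R by apply: commr_nat.
have cs : GRing.comm z (delta c1 + delta c4).
  by rewrite -[X in GRing.comm _ X] (subrK 2%:R); apply: commrD.
have ct : GRing.comm z (delta c2 + delta c3).
  by rewrite -[X in GRing.comm _ X] (subrK 2%:R); apply: commrD.
have [cd1 cd4] := comm_add_sub cs ca.
have [cd2 cd3] := comm_add_sub ct cb.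
move=> x; rewrite (dirac_sumE x) sum5.
by do ?apply: commrD; apply: commrZ => //; apply: commr1.
Qed.

End OrderFive.

Theorem proposition4p1 (R : realType) (K : finType) (c0 c1 c2 c3 c4 : K)
    (c_distinct : uniq [:: c0; c1; c2; c3; c4])
    (c_all : forall x : K, x \in [:: c0; c1; c2; c3; c4])
    (H : hypergroup R c0)
    (inv0 : hg_inv H c0 = c0) (inv1 : hg_inv H c1 = c4) (inv2 : hg_inv H c2 = c3)
    (inv3 : hg_inv H c3 = c2) (inv4 : hg_inv H c4 = c1) :
  commutative_hypergroup H.
Proof.
have cab := comm_ab c_distinct c_all inv0 inv1 inv2 inv3 inv4.
have center := comm_all c_distinct c_all inv0 inv1 inv2 inv3 inv4.
(* [center] serves twice: with [z] equal to [a] or [b] it makes these central, and then with [z = x]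
   it gives the claim. *)
by move=> x y; apply: (center x); apply: commr_sym; apply: (center _).
Qed.
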